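(* (1) Every linearly ordered MV-algebra can be embedded into an ultraproduct of finite linearly ordered MV-algebras. (2) Every MV-algebra can be embedded into a direct product of ultraproducts of finite linearly ordered MV-algebras. (3) Every MV-algebra can be embedded into an ultraproduct of finite MV-algebras (each of which is embeddable into a finite direct power of a finite linearly ordered MV-algebra).
   Context: An MV-algebra is an algebra $(A,\oplus,\neg,0)$ of type $(2,1,0)$ such that $\oplus$ is commutative and associative, $x\oplus 0=x$, $\neg\neg x=x$, $x\oplus 1=1$ where $1:=\neg 0$, and $\neg(\neg x\oplus y)\oplus y=\neg(\neg y\oplus x)\oplus x$; its order is $x\leq y$ iff $\neg x\oplus y=1$, and it is linearly ordered (an MV-chain) if this order is total. Ultraproducts are taken in the usual universal-algebraic sense: for algebras $\mathbf A_i$ ($i\in I$) and an ultrafilter $U$ on $I$, $(\prod_{i\in I}\mathbf A_i)/U$ is the quotient of the product by the congruence identifying $x,y$ iff $\{i: x(i)=y(i)\}\in U$. *)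

(* Defs.v *)
From HB Require Import structures.
From mathcomp Require Import all_boot.
From mathcomp Require Import boolp classical_sets cardinality filter.
Set Implicit Arguments.
Unset Strict Implicit.
Unset Printing Implicit Defensive.
Local Open Scope classical_set_scope.
Local Open Scope quotient_scope.

Declare Scope mv_scope.
Delimit Scope mv_scope with MV.
Local Open Scope mv_scope.

Reserved Notation "x ⊕ y" (at level 50, left associativity).
Reserved Notation "¬ x" (at level 35, right associativity).

HB.mixin Record isMVAlgebra (A : Type) := {
  mv_oplus : A -> A -> A;
  mv_neg : A -> A;
  mv_zero : A;
  mv_oplusA : associative mv_oplus;
  mv_oplusC : commutative mv_oplus;
  mv_oplusx0 : right_id mv_zero mv_oplus;
  mv_negK : involutive mv_neg;
  mv_oplusx1 : right_zero (mv_neg mv_zero) mv_oplus;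
  mv_lukasiewicz : forall x y,
    mv_oplus (mv_neg (mv_oplus (mv_neg x) y)) y =
    mv_oplus (mv_neg (mv_oplus (mv_neg y) x)) x
}.

#[short(type="mvAlgebra")]
HB.structure Definition MVAlgebra := {A of isMVAlgebra A}.

Notation "x ⊕ y" := (mv_oplus x y) : mv_scope.
Notation "¬ x" := (mv_neg x) : mv_scope.

Definition mv_one {A : mvAlgebra} : A := ¬ mv_zero.

Definition mv_le {A : mvAlgebra} (x y : A) : Prop := ¬ x ⊕ y = mv_one.

Definition mv_chain (A : mvAlgebra) : Prop :=
  forall x y : A, mv_le x y \/ mv_le y x.

Definition mv_finite (A : mvAlgebra) : Prop := finite_set [set: A].

Definition mv_morphism (A B : mvAlgebra) (f : A -> B) : Prop :=
  [/\ forall x y, f (x ⊕ y) = f x ⊕ f y,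
      forall x, f (¬ x) = ¬ f x
    & f mv_zero = mv_zero].

Definition mv_embeds (A B : mvAlgebra) : Prop :=
  exists2 f : A -> B, mv_morphism f & injective f.

Definition mv_prod (I : Type) (A : I -> mvAlgebra) : Type := forall i, A i.

Section DirectProduct.
Variables (I : Type) (A : I -> mvAlgebra).
Implicit Types x y z : mv_prod A.

Definition mv_prod_oplus x y : mv_prod A := fun i => x i ⊕ y i.
Definition mv_prod_neg x : mv_prod A := fun i => ¬ x i.
Definition mv_prod_zero : mv_prod A := fun i => mv_zero.

Fact mv_prod_oplusA : associative mv_prod_oplus.
Proof. by move=> x y z; apply: functional_extensionality_dep => i; apply: mv_oplusA. Qed.

Fact mv_prod_oplusC : commutative mv_prod_oplus.
Proof. by move=> x y; apply: functional_extensionality_dep => i; apply: mv_oplusC. Qed.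

Fact mv_prod_oplusx0 : right_id mv_prod_zero mv_prod_oplus.
Proof. by move=> x; apply: functional_extensionality_dep => i; apply: mv_oplusx0. Qed.

Fact mv_prod_negK : involutive mv_prod_neg.
Proof. by move=> x; apply: functional_extensionality_dep => i; apply: mv_negK. Qed.

Fact mv_prod_oplusx1 : right_zero (mv_prod_neg mv_prod_zero) mv_prod_oplus.
Proof. by move=> x; apply: functional_extensionality_dep => i; apply: mv_oplusx1. Qed.

Fact mv_prod_lukasiewicz x y :
  mv_prod_oplus (mv_prod_neg (mv_prod_oplus (mv_prod_neg x) y)) y =
  mv_prod_oplus (mv_prod_neg (mv_prod_oplus (mv_prod_neg y) x)) x.
Proof. by apply: functional_extensionality_dep => i; apply: mv_lukasiewicz. Qed.

HB.instance Definition _ := isMVAlgebra.Build (mv_prod A)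
  mv_prod_oplusA mv_prod_oplusC mv_prod_oplusx0 mv_prod_negK mv_prod_oplusx1
  mv_prod_lukasiewicz.

End DirectProduct.

Section Ultraproduct.
Variables (I : Type) (A : I -> mvAlgebra) (U : set_system I).
Hypothesis UF : UltraFilter U.

(* {classic _} supplies the choiceType needed to form a quotient type. *)
Let P := {classic mv_prod A}.

Definition ultra_eq (x y : P) : bool := `[< U [set i | x i = y i] >].

Fact ultra_eq_refl : reflexive ultra_eq.
Proof. by move=> x; apply/asboolP; apply: filterE. Qed.

Fact ultra_eq_sym : symmetric ultra_eq.
Proof.
by move=> x y; apply/asboolP/asboolP; apply: filterS => i /= ->.
Qed.

Fact ultra_eq_trans : transitive ultra_eq.
Proof.
move=> y x z /asboolP xy /asboolP yz; apply/asboolP.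
by move: xy yz; apply: filterS2 => i /= -> ->.
Qed.

Canonical ultra_eq_equiv :=
  EquivRel ultra_eq ultra_eq_refl ultra_eq_sym ultra_eq_trans.

Definition ultraproduct : Type := {eq_quot ultra_eq_equiv}.

Definition ultra_class (x : mv_prod A) : ultraproduct :=
  \pi_{eq_quot ultra_eq_equiv} (x : P).

Definition ultra_repr (a : ultraproduct) : mv_prod A :=
  repr (a : {eq_quot ultra_eq_equiv}).

Lemma ultra_reprK : cancel ultra_repr ultra_class.
Proof. exact: reprK. Qed.

Lemma ultra_class_eq (x y : mv_prod A) :
  ultra_class x = ultra_class y <-> U [set i | x i = y i].
Proof. by split=> [/eqmodP/asboolP|h] //; apply/eqmodP/asboolP. Qed.

Lemma ultra_classK (x : mv_prod A) :
  U [set i | ultra_repr (ultra_class x) i = x i].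
Proof. by apply/ultra_class_eq; rewrite ultra_reprK. Qed.

Definition ultra_oplus (a b : ultraproduct) : ultraproduct :=
  ultra_class (ultra_repr a ⊕ ultra_repr b).
Definition ultra_neg (a : ultraproduct) : ultraproduct :=
  ultra_class (¬ ultra_repr a).
Definition ultra_zero : ultraproduct := ultra_class mv_zero.

Lemma ultra_class_oplus (x y : mv_prod A) :
  ultra_class (x ⊕ y) = ultra_oplus (ultra_class x) (ultra_class y).
Proof.
apply/ultra_class_eq; move: (ultra_classK x) (ultra_classK y).
apply: filterS2 => i /= ex ey.
by rewrite -[LHS]/(x i ⊕ y i) -ex -ey.
Qed.

Lemma ultra_class_neg (x : mv_prod A) :
  ultra_class (¬ x) = ultra_neg (ultra_class x).
Proof.
apply/ultra_class_eq; move: (ultra_classK x); apply: filterS => i /= ex.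
by rewrite -[LHS]/(¬ x i) -ex.
Qed.

Fact ultra_oplusA : associative ultra_oplus.
Proof.
move=> a b c; rewrite -[a]ultra_reprK -[b]ultra_reprK -[c]ultra_reprK.
by rewrite -!ultra_class_oplus mv_oplusA.
Qed.

Fact ultra_oplusC : commutative ultra_oplus.
Proof. by move=> a b; rewrite /ultra_oplus mv_oplusC. Qed.

Fact ultra_oplusx0 : right_id ultra_zero ultra_oplus.
Proof.
by move=> a; rewrite -[a]ultra_reprK -ultra_class_oplus mv_oplusx0.
Qed.

Fact ultra_negK : involutive ultra_neg.
Proof. by move=> a; rewrite -[a]ultra_reprK -!ultra_class_neg mv_negK. Qed.

Fact ultra_oplusx1 : right_zero (ultra_neg ultra_zero) ultra_oplus.
Proof.
move=> a; rewrite -[a]ultra_reprK -ultra_class_neg -ultra_class_oplus.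
by rewrite mv_oplusx1.
Qed.

Fact ultra_lukasiewicz a b :
  ultra_oplus (ultra_neg (ultra_oplus (ultra_neg a) b)) b =
  ultra_oplus (ultra_neg (ultra_oplus (ultra_neg b) a)) a.
Proof.
rewrite -[a]ultra_reprK -[b]ultra_reprK.
by rewrite -!(ultra_class_neg, ultra_class_oplus) mv_lukasiewicz.
Qed.

HB.instance Definition _ := isMVAlgebra.Build ultraproduct
  ultra_oplusA ultra_oplusC ultra_oplusx0 ultra_negK ultra_oplusx1
  ultra_lukasiewicz.

End Ultraproduct.

Arguments ultraproduct {I} A {U} UF.

Definition mv_power (n : nat) (C : mvAlgebra) : mvAlgebra :=
  mv_prod (fun _ : 'I_n => C).

(* Main.v *)
(** Finite partial subalgebras of an MV-chain [C] embed into finite MV-chains: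
    [C] is the unit interval of a totally ordered abelian group [G] (Chang), and
    Fourier-Motzkin elimination provides, for any finitely many integral linear
    forms evaluated at elements of [G], rational numbers at which these forms
    take the same signs; clearing denominators lands in a finite chain. An
    ultrafilter on the finite subsets that contains the upper cone of each of
    them glues these partial embeddings, which is (1). An ideal maximal among those avoiding a nonzero
    element is prime, so morphisms to chains separate points; this reduces (2)
    to (1), and for (3) it provides partial embeddings of finite subsets into
    finite powers of finite chains, with one common denominator. *)

Require Import Defs.
From HB Require Import structures.
From mathcomp Require Import all_boot.
From mathcomp Require Import boolp classical_sets cardinality filter.
From mathcomp Require Import order ssralg ssrnum ssrint rat archimedean zify ring lra.

Set Implicit Arguments.
Unset Strict Implicit.
Unset Printing Implicit Defensive.
Import Order.TTheory GRing.Theory Num.Theory.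
Local Open Scope mv_scope.

(** * Order and differences *)

(** Truncated difference: on the real unit interval, max(0, x - y). *)
Definition mv_minus (A : mvAlgebra) (x y : A) : A := ¬ (¬ x ⊕ y).
Notation "x ⊖ y" := (mv_minus x y) (at level 50, left associativity) : mv_scope.

Definition mv_meet (A : mvAlgebra) (x y : A) : A := x ⊖ (x ⊖ y).
Notation "x ⊓ y" := (mv_meet x y) (at level 40, left associativity) : mv_scope.

Section Order.
Variable A : mvAlgebra.
Implicit Types x y z w d u : A.

Lemma mv_oplus0x x : mv_zero ⊕ x = x.
Proof. by rewrite mv_oplusC mv_oplusx0. Qed.

Lemma mv_neg1 : ¬ mv_one = mv_zero :> A.
Proof. exact: mv_negK. Qed.

Lemma mv_oplus1 x : x ⊕ mv_one = mv_one.
Proof. exact: mv_oplusx1. Qed.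

Lemma mv_oplusCA x y z : x ⊕ (y ⊕ z) = y ⊕ (x ⊕ z).
Proof. by rewrite !mv_oplusA (mv_oplusC x). Qed.

(** This is the Łukasiewicz axiom with 1 as second argument. *)
Lemma mv_oplusN x : ¬ x ⊕ x = mv_one.
Proof.
have := mv_lukasiewicz x mv_one.
by rewrite !mv_oplus1 mv_neg1 mv_oplus0x => <-.
Qed.

Lemma mv_le_refl x : mv_le x x.
Proof. exact: mv_oplusN. Qed.

Lemma mv_le_oplusr x z : mv_le x (x ⊕ z).
Proof. by rewrite /mv_le mv_oplusA mv_oplusN mv_oplusC mv_oplus1. Qed.

Lemma mv_le_oplusl x z : mv_le x (z ⊕ x).
Proof. by rewrite mv_oplusC; apply: mv_le_oplusr. Qed.

(** The Łukasiewicz axiom turns the left side into [¬ (¬ x ⊕ y) ⊕ y], whose first summand is 0.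
    Elements above [x] thus have the form [d ⊕ x], from which transitivity and monotonicity are read
    off. *)
Lemma mv_minusK x y : mv_le x y -> (y ⊖ x) ⊕ x = y.
Proof. by rewrite /mv_minus mv_lukasiewicz => ->; rewrite mv_neg1 mv_oplus0x. Qed.

Lemma mv_le_trans y x z : mv_le x y -> mv_le y z -> mv_le x z.
Proof.
move=> /mv_minusK <- /mv_minusK <-.
by rewrite mv_oplusA; apply: mv_le_oplusl.
Qed.

Lemma mv_le_anti x y : mv_le x y -> mv_le y x -> x = y.
Proof.
by move=> xy yx; rewrite -(mv_minusK xy) /mv_minus yx mv_neg1 mv_oplus0x.
Qed.

Lemma mv_le_oplus x y z w : mv_le x y -> mv_le z w -> mv_le (x ⊕ z) (y ⊕ w).
Proof.
move=> /mv_minusK <- /mv_minusK <-.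
rewrite -mv_oplusA [x ⊕ (_ ⊕ z)]mv_oplusCA mv_oplusA.
exact: mv_le_oplusl.
Qed.

(** Residuation: both sides unfold to the same equation up to associativity. It moves summands
    across inequalities in what follows. *)
Lemma mv_le_minusl x y z : mv_le (x ⊖ y) z <-> mv_le x (y ⊕ z).
Proof. by rewrite /mv_le /mv_minus mv_negK mv_oplusA. Qed.

Lemma mv_le_neg x y : mv_le (¬ y) (¬ x) <-> mv_le x y.
Proof. by rewrite /mv_le mv_negK mv_oplusC. Qed.

Lemma mv_le0 x : mv_le mv_zero x.
Proof. by rewrite -(mv_oplus0x x); apply: mv_le_oplusr. Qed.

Lemma mv_le1 x : mv_le x mv_one.
Proof. exact: mv_oplus1. Qed.

Lemma mv_le1_eq x : mv_le mv_one x -> x = mv_one.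
Proof. by move=> h; apply: mv_le_anti => //; apply: mv_le1. Qed.

Lemma mv_le0_eq x : mv_le x mv_zero -> x = mv_zero.
Proof. by move=> h; apply: mv_le_anti => //; apply: mv_le0. Qed.

Lemma mv_le_minusx x y : mv_le (x ⊖ y) x.
Proof. by apply/mv_le_minusl; apply: mv_le_oplusl. Qed.

Lemma mv_le_oplus_minus x y : mv_le x (y ⊕ (x ⊖ y)).
Proof. by apply/mv_le_minusl; apply: mv_le_refl. Qed.

Lemma mv_minusxx x : x ⊖ x = mv_zero.
Proof. by rewrite /mv_minus mv_oplusN mv_neg1. Qed.

Lemma mv_minus_eq0 x y : x ⊖ y = mv_zero <-> mv_le x y.
Proof.
split=> [h|h]; last by rewrite /mv_minus h mv_neg1.
by rewrite /mv_le -[LHS]mv_negK -/(x ⊖ y) h.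
Qed.

Lemma mv_neg_minus x y : ¬ x ⊖ ¬ y = y ⊖ x.
Proof. by rewrite /mv_minus mv_negK mv_oplusC. Qed.

(** Cancellation is legitimate here because the hypothesis says that [x ⊕ d] is not truncated. *)
Lemma mv_oplusK x d : mv_le x (¬ d) -> (x ⊕ d) ⊖ d = x.
Proof.
have := mv_lukasiewicz (¬ x) d; rewrite !mv_negK /mv_minus => -> h.
by rewrite [¬ d ⊕ _]mv_oplusC h mv_neg1 mv_oplus0x mv_negK.
Qed.

Lemma mv_meetC x y : x ⊓ y = y ⊓ x.
Proof.
rewrite /mv_meet /mv_minus; congr (¬ _).
have := mv_lukasiewicz (¬ y) (¬ x); rewrite !mv_negK => h.
rewrite [LHS]mv_oplusC (mv_oplusC (¬ x) y) h.
by rewrite [LHS]mv_oplusC (mv_oplusC (¬ y) x).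
Qed.

Lemma mv_meet_lel x y : mv_le (x ⊓ y) x.
Proof. exact: mv_le_minusx. Qed.

Lemma mv_meet_ler x y : mv_le (x ⊓ y) y.
Proof. by rewrite mv_meetC; apply: mv_meet_lel. Qed.

Lemma mv_le_minus x y z w : mv_le x y -> mv_le w z -> mv_le (x ⊖ z) (y ⊖ w).
Proof.
move=> xy wz; apply/mv_le_minusl; apply: mv_le_trans xy _.
apply: mv_le_trans (mv_le_oplus_minus y w) _.
by apply: mv_le_oplus => //; apply: mv_le_refl.
Qed.

Lemma mv_le_meet x y z : mv_le z x -> mv_le z y -> mv_le z (x ⊓ y).
Proof.
move=> zx zy; have -> : z = x ⊖ (x ⊖ z).
  rewrite -/(x ⊓ z) mv_meetC /mv_meet; move/mv_minus_eq0: zx => ->.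
  by rewrite /mv_minus mv_oplusx0 mv_negK.
by apply: mv_le_minus; [apply: mv_le_refl|apply: mv_le_minus => //; apply: mv_le_refl].
Qed.

Lemma mv_meetxx x : x ⊓ x = x.
Proof.
by apply: mv_le_anti; [apply: mv_meet_lel|apply: mv_le_meet; apply: mv_le_refl].
Qed.

Lemma mv_le_meet2 x y z w : mv_le x y -> mv_le z w -> mv_le (x ⊓ z) (y ⊓ w).
Proof.
move=> xy zw; apply: mv_le_meet.
  exact: mv_le_trans (mv_meet_lel _ _) xy.
exact: mv_le_trans (mv_meet_ler _ _) zw.
Qed.

(** For [w] the left side, residuation strips off the two summands in turn: every [w ⊖ z] is below
    [u], and what remains is [w ≤ x ⊕ y]. This makes [mv_colon] closed under sums. *)
Lemma mv_meet_oplus x y u : mv_le ((x ⊕ y) ⊓ u) ((x ⊓ u) ⊕ (y ⊓ u)).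
Proof.
have wxy := mv_meet_lel (x ⊕ y) u; have wu := mv_meet_ler (x ⊕ y) u.
move: (_ ⊓ u) wxy wu => w wxy wu.
have le_u z : mv_le (w ⊖ z) u by apply: mv_le_trans wu; apply: mv_le_minusx.
apply/mv_le_minusl; apply: mv_le_meet => //.
apply/mv_le_minusl; rewrite mv_oplusC; apply/mv_le_minusl; apply: mv_le_meet => //.
by apply/mv_le_minusl; rewrite mv_oplusC.
Qed.

(* With m = x ⊓ y, any lower bound w of both differences satisfies m ⊕ w ≤ m
   and w ≤ ¬ m, hence w = 0 by cancellation. *)
Lemma mv_minus_meet x y : (x ⊖ y) ⊓ (y ⊖ x) = mv_zero.
Proof.
set w := _ ⊓ _; set m := x ⊓ y.
have wx : mv_le w (x ⊖ m).
  apply: mv_le_trans (mv_meet_lel _ _) _.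
  by apply: mv_le_minus; [apply: mv_le_refl|apply: mv_meet_ler].
have wy : mv_le w (y ⊖ m).
  apply: mv_le_trans (mv_meet_ler _ _) _.
  by apply: mv_le_minus; [apply: mv_le_refl|apply: mv_meet_lel].
have wm : mv_le w (¬ m).
  apply: mv_le_trans wx _; rewrite /mv_minus; apply/mv_le_neg.
  exact: mv_le_oplusl.
have le z : mv_le m z -> mv_le w (z ⊖ m) -> mv_le (w ⊕ m) z.
  by move=> mz wz; rewrite -(mv_minusK mz); apply: mv_le_oplus => //; apply: mv_le_refl.
have wmm : w ⊕ m = m.
  apply: mv_le_anti; last exact: mv_le_oplusl.
  by rewrite {2}/m; apply: mv_le_meet; apply: le => //;
    [apply: mv_meet_lel|apply: mv_meet_ler].
by rewrite -(mv_oplusK wm) wmm mv_minusxx.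
Qed.

(** Gives transitivity of the congruence of an ideal; [mv_minus_oplus] gives its compatibility with
    sums. *)
Lemma mv_minus_triangle y x z : mv_le (x ⊖ z) ((x ⊖ y) ⊕ (y ⊖ z)).
Proof.
apply/mv_le_minusl; apply: mv_le_trans (mv_le_oplus_minus x y) _.
rewrite [z ⊕ _]mv_oplusC -mv_oplusA mv_oplusC.
apply: mv_le_oplus; first exact: mv_le_refl.
by rewrite mv_oplusC; apply: mv_le_oplus_minus.
Qed.

Lemma mv_minus_oplus x y z w :
  mv_le ((x ⊕ y) ⊖ (z ⊕ w)) ((x ⊖ z) ⊕ (y ⊖ w)).
Proof.
apply/mv_le_minusl; rewrite -mv_oplusA [w ⊕ _]mv_oplusCA mv_oplusA.
by apply: mv_le_oplus; apply: mv_le_oplus_minus.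
Qed.

End Order.

(** * Prime ideals and quotients *)

Section Ideals.
Variable A : mvAlgebra.
Local Open Scope classical_set_scope.

Definition mv_ideal (P : set A) :=
  [/\ P mv_zero, forall x y, P x -> P y -> P (x ⊕ y)
    & forall x y, mv_le x y -> P y -> P x].

(** The ideal quotient P : u, with meets in place of products. *)
Definition mv_colon (P : set A) (u : A) : set A := [set x | P (x ⊓ u)].

Lemma mv_colon_ideal (P : set A) u : mv_ideal P -> mv_ideal (mv_colon P u).
Proof.
move=> [P0 PD Ple]; split => /=.
- by apply: Ple P0; apply: mv_meet_lel.
- by move=> x y Px Py; apply: Ple (mv_meet_oplus x y u) _; apply: PD.
- move=> x y xy; apply: Ple; apply: mv_le_meet2 => //; exact: mv_le_refl.
Qed.

Lemma sub_mv_colon (P : set A) u : mv_ideal P -> P `<=` mv_colon P u.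
Proof. by move=> [_ _ Ple] x; apply: Ple; apply: mv_meet_lel. Qed.

Lemma exists_maximal_mv_ideal (c : A) : c <> mv_zero ->
  exists P : set A, [/\ mv_ideal P, ~ P c &
    forall Q, mv_ideal Q -> P `<=` Q -> ~ Q c -> Q `<=` P].
Proof.
move=> c0.
(* Membership of 0 is left out of [S], since Zorn's lemma also asks for the union of the empty
   chain. A maximal member contains 0 anyway: if empty, it would lie strictly below
   [[set mv_zero]]. *)
pose S : set (set A) := [set P | [/\ forall x y, P x -> P y -> P (x ⊕ y),
  forall x y, mv_le x y -> P y -> P x & ~ P c]].
have [F FS Ftot|P [[PD Ple Pc] maxP]] := @Zorn_bigcup A S.
  split=> [x y [P FP Px] [Q FQ Qy]|x y xy [P FP Py]|[P /FS[_ _ Pc]]] //.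
    have [h|h] := Ftot _ _ FP FQ.
      by exists Q => //; case: (FS _ FQ) => QD _ _; apply: QD => //; apply: h.
    by exists P => //; case: (FS _ FP) => PD _ _; apply: PD => //; apply: h.
  by exists P => //; case: (FS _ FP) => _ Ple _; apply: Ple Py.
have {}maxP Q : S Q -> P `<=` Q -> Q `<=` P.
  by move=> SQ PQ; apply: contrapT => QP; apply: (maxP Q).
have P0 : P mv_zero.
  have [[x Px]|nP] := pselect (exists x, P x); first by apply: Ple Px; apply: mv_le0.
  apply: (maxP [set mv_zero]) => //; last by move=> x Px; case: nP; exists x.
  split=> //= [x y -> ->|x y xy ey]; first exact: mv_oplusx0.
  by apply: mv_le0_eq; rewrite -ey.
by exists P; split=> // Q [_ QD Qle] PQ Qc; apply: maxP.
Qed.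

(* If x and y both escape P while x ⊓ y does not, then maximality puts c in
   (P : x), hence x in (P : c), hence c in (P : c), that is c = c ⊓ c in P. *)
Lemma maximal_mv_ideal_prime (c : A) (P : set A) : mv_ideal P -> ~ P c ->
  (forall Q, mv_ideal Q -> P `<=` Q -> ~ Q c -> Q `<=` P) ->
  forall x y, P (x ⊓ y) -> P x \/ P y.
Proof.
move=> hP Pc maxP x y Pxy.
have key u v : P (u ⊓ v) -> P u \/ P (c ⊓ v).
  move=> Puv; have [Pcv|Pcv] := pselect (P (c ⊓ v)); [by right|left].
  apply: (maxP (mv_colon P v)) => //; first exact: mv_colon_ideal.
  exact: sub_mv_colon.
have [Px|Pcy] := key _ _ Pxy; [by left|right].
rewrite mv_meetC in Pcy; have [//|] := key _ _ Pcy.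
by rewrite mv_meetxx.
Qed.
End Ideals.

(** * The quotient of an MV-algebra by an ideal *)

Section Quotient.
Variables (A : mvAlgebra) (P : set A).
Hypothesis idP : mv_ideal P.
Local Open Scope quotient_scope.

Definition mv_cong (x y : {classic A}) : bool :=
  `[< P ((x : A) ⊖ y) /\ P ((y : A) ⊖ x) >].

Fact mv_cong_refl : reflexive mv_cong.
Proof. by move=> x; apply/asboolP; rewrite mv_minusxx; case: idP. Qed.

Fact mv_cong_sym : symmetric mv_cong.
Proof. by move=> x y; apply/asboolP/asboolP => -[]. Qed.

Fact mv_cong_trans : transitive mv_cong.
Proof.
case: idP => _ PD Ple y x z /asboolP[xy yx] /asboolP[yz zy].
by apply/asboolP; split; apply: Ple (mv_minus_triangle y _ _) _; apply: PD.
Qed.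

Canonical mv_cong_equiv :=
  EquivRel mv_cong mv_cong_refl mv_cong_sym mv_cong_trans.

Definition mv_quotient : Type := {eq_quot mv_cong_equiv}.

Definition mv_class (x : A) : mv_quotient :=
  \pi_{eq_quot mv_cong_equiv} (x : {classic A}).

Definition mv_repr (a : mv_quotient) : A :=
  repr (a : {eq_quot mv_cong_equiv}).

Lemma mv_reprK : cancel mv_repr mv_class.
Proof. exact: reprK. Qed.

Lemma mv_class_eq (x y : A) :
  mv_class x = mv_class y <-> P (x ⊖ y) /\ P (y ⊖ x).
Proof. by split=> [/eqmodP/asboolP|h] //; apply/eqmodP/asboolP. Qed.

Definition mv_quotient_oplus (a b : mv_quotient) := mv_class (mv_repr a ⊕ mv_repr b).
Definition mv_quotient_neg (a : mv_quotient) := mv_class (¬ mv_repr a).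
Definition mv_quotient_zero := mv_class mv_zero.

Lemma mv_class_oplus x y :
  mv_class (x ⊕ y) = mv_quotient_oplus (mv_class x) (mv_class y).
Proof.
have /mv_class_eq[x1 x2] := esym (mv_reprK (mv_class x)).
have /mv_class_eq[y1 y2] := esym (mv_reprK (mv_class y)).
case: idP => _ PD Ple.
by apply/mv_class_eq; split; apply: Ple (mv_minus_oplus _ _ _ _) _; apply: PD.
Qed.

Lemma mv_class_neg x : mv_class (¬ x) = mv_quotient_neg (mv_class x).
Proof.
have /mv_class_eq[x1 x2] := mv_reprK (mv_class x).
by apply/mv_class_eq; rewrite !mv_neg_minus.
Qed.

Fact mv_quotient_oplusA : associative mv_quotient_oplus.
Proof.
move=> a b c; rewrite -[a]mv_reprK -[b]mv_reprK -[c]mv_reprK.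
by rewrite -!mv_class_oplus mv_oplusA.
Qed.

Fact mv_quotient_oplusC : commutative mv_quotient_oplus.
Proof. by move=> a b; rewrite /mv_quotient_oplus mv_oplusC. Qed.

Fact mv_quotient_oplusx0 : right_id mv_quotient_zero mv_quotient_oplus.
Proof. by move=> a; rewrite -[a]mv_reprK -mv_class_oplus mv_oplusx0. Qed.

Fact mv_quotient_negK : involutive mv_quotient_neg.
Proof. by move=> a; rewrite -[a]mv_reprK -!mv_class_neg mv_negK. Qed.

Fact mv_quotient_oplusx1 :
  right_zero (mv_quotient_neg mv_quotient_zero) mv_quotient_oplus.
Proof.
by move=> a; rewrite -[a]mv_reprK -mv_class_neg -mv_class_oplus mv_oplusx1.
Qed.

Fact mv_quotient_lukasiewicz a b :
  mv_quotient_oplus (mv_quotient_neg (mv_quotient_oplus (mv_quotient_neg a) b)) b =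
  mv_quotient_oplus (mv_quotient_neg (mv_quotient_oplus (mv_quotient_neg b) a)) a.
Proof.
rewrite -[a]mv_reprK -[b]mv_reprK.
by rewrite -!(mv_class_neg, mv_class_oplus) mv_lukasiewicz.
Qed.

HB.instance Definition _ := isMVAlgebra.Build mv_quotient
  mv_quotient_oplusA mv_quotient_oplusC mv_quotient_oplusx0 mv_quotient_negK
  mv_quotient_oplusx1 mv_quotient_lukasiewicz.

Lemma mv_class_morphism : mv_morphism mv_class.
Proof. by split=> // [x y|x]; [apply: mv_class_oplus|apply: mv_class_neg]. Qed.

Lemma mv_class_le x y : P (x ⊖ y) -> mv_le (mv_class x) (mv_class y).
Proof.
move=> Pxy; apply/mv_minus_eq0; case: mv_class_morphism => mD mN m0.
rewrite /mv_minus -mN -mD -mN -m0; apply/mv_class_eq.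
case: idP => _ _ Ple; split; first by apply: Ple Pxy; apply: mv_le_minusx.
by apply: Ple Pxy; apply: mv_le_trans (mv_le0 _); apply: mv_le_minusx.
Qed.

End Quotient.

(** One of the two differences is nonzero; divide by an ideal maximal among those avoiding it. The
    ideal is prime and contains [(p ⊖ q) ⊓ (q ⊖ p)], which is 0, so the quotient is totally ordered.
    Identifying the two points would put the avoided difference into the ideal. *)
Lemma mv_chain_separation (A : mvAlgebra) (x y : A) : x <> y ->
  exists (C : mvAlgebra) (h : A -> C), [/\ mv_chain C, mv_morphism h & h x <> h y].
Proof.
have key (a b : A) : ~ mv_le a b ->
    exists (C : mvAlgebra) (h : A -> C), [/\ mv_chain C, mv_morphism h & h a <> h b].
  move=> ab; have [|P [idP Pc maxP]] := @exists_maximal_mv_ideal A (a ⊖ b).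
    by move/mv_minus_eq0.
  exists (mv_quotient idP), (mv_class idP); split.
  - move=> p q; rewrite -[p]mv_reprK -[q]mv_reprK.
    have [P0 _ _] := idP; move: P0; rewrite -(mv_minus_meet (mv_repr p) (mv_repr q)).
    by case/(maximal_mv_ideal_prime idP Pc maxP) => h; [left|right]; apply: mv_class_le.
  - exact: mv_class_morphism.
  - by move=> /mv_class_eq[].
move=> xy; have [le|/key//] := pselect (mv_le x y).
have [|C [h [chC mh hxy]]] := key y x; last by exists C, h; split=> // /esym.
by move=> le'; apply: xy; apply: mv_le_anti.
Qed.

(** * Chang's group of an MV-chain *)

Section ChainArithmetic.
Variable C : mvAlgebra.
Hypothesis chainC : mv_chain C.
Implicit Types a b c d : C.
Local Notation "1" := (mv_one : C).

(** On the unit interval, max(0, a + b - 1): what an overflowing sum leaves after a unit is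
    carried. *)
Definition mv_otimes a b : C := ¬ (¬ a ⊕ ¬ b).
Local Notation "a ⊙ b" := (mv_otimes a b) (at level 40, left associativity).

Lemma mv_otimesC a b : a ⊙ b = b ⊙ a.
Proof. by rewrite /mv_otimes mv_oplusC. Qed.

Lemma mv_otimesA a b c : a ⊙ (b ⊙ c) = a ⊙ b ⊙ c.
Proof. by rewrite /mv_otimes !mv_negK mv_oplusA. Qed.

Lemma mv_otimes_minus a b : a ⊙ b = b ⊖ ¬ a.
Proof. by rewrite mv_otimesC. Qed.

Lemma mv_otimes_ler a b : mv_le (a ⊙ b) b.
Proof. by rewrite mv_otimes_minus; apply: mv_le_minusx. Qed.

Lemma mv_otimes_neq1 a b : b <> 1 -> a ⊙ b <> 1.
Proof. by move=> b1 e; apply/b1/mv_le1_eq; rewrite -e; apply: mv_otimes_ler. Qed.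

(** Associativity of addition with carry when only the first pair overflows. With [d = ¬ a] and
    [b = e ⊕ d], it is cancellation of [d] from [e ⊕ c ⊕ d]. Its condition [e ⊕ c ≤ a] follows from
    totality, since the reverse inequality forces [b ⊕ c] up to 1. *)
Lemma mv_chain_otimes_oplus a b c : a ⊕ b = 1 -> b ⊕ c <> 1 ->
  a ⊙ (b ⊕ c) = (a ⊙ b) ⊕ c.
Proof.
move=> ab bc; have db : mv_le (¬ a) b by rewrite /mv_le mv_negK.
rewrite !mv_otimes_minus; set d := ¬ a; set e := b ⊖ d.
have eb : e ⊕ d = b by apply: mv_minusK.
rewrite -eb -mv_oplusA [d ⊕ c]mv_oplusC mv_oplusA; apply: mv_oplusK.
rewrite mv_negK; have [//|h] := chainC (e ⊕ c) a.
case: bc; apply: mv_le1_eq; rewrite -(mv_oplusN a) -eb mv_oplusC.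
have -> : e ⊕ d ⊕ c = (e ⊕ c) ⊕ ¬ a by rewrite -!mv_oplusA [c ⊕ _]mv_oplusC.
by apply: mv_le_oplus => //; apply: mv_le_refl.
Qed.

(** When both pairs overflow, a second carry on one side forces one on the other. With [d = ¬ a] and
    [f = ¬ c], the goal reads [d ≤ b ⊖ f]. If it failed, [b] would be [d ⊕ f]; then either [d ≤ c]
    and cancellation gives [b ⊖ f = d], or [c ≤ d] and [b] is 1. *)
Lemma mv_chain_carry a b c : a ⊕ b = 1 -> b ⊕ c = 1 -> b <> 1 ->
  (a ⊙ b) ⊕ c = 1 -> a ⊕ (b ⊙ c) = 1.
Proof.
move=> ab bc b1 pc.
have db : mv_le (¬ a) b by rewrite /mv_le mv_negK.
have fb : mv_le (¬ c) b by rewrite /mv_le mv_negK mv_oplusC.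
rewrite [b ⊙ c]mv_otimesC mv_otimes_minus; rewrite mv_otimes_minus in pc.
have pd : (b ⊖ ¬ a) ⊕ ¬ a = b by apply: mv_minusK.
set d := ¬ a in db pd pc *; set f := ¬ c in fb *; rewrite -[a]mv_negK -/d.
have [//|h] := chainC d (b ⊖ f).
have fp : mv_le f (b ⊖ d) by rewrite /f /mv_le mv_negK mv_oplusC.
have efd : d ⊕ f = b.
  apply: mv_le_anti; last by rewrite mv_oplusC; apply/mv_le_minusl.
  by rewrite -[X in mv_le _ X]pd mv_oplusC; apply: mv_le_oplus => //; apply: mv_le_refl.
have [dc|cd] := chainC d c.
  have -> : b ⊖ f = d by rewrite -efd; apply: mv_oplusK; rewrite /f mv_negK.
  exact: mv_oplusN.
case: b1; apply: mv_le1_eq; rewrite -pd -pc.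
by apply: mv_le_oplus => //; apply: mv_le_refl.
Qed.

(** By symmetry the first argument may be taken below the third. Then [y ⊙ z] splits as
    [(z ⊖ x) ⊕ (x ⊙ y)], and adding [x] restores [z]. *)
Lemma mv_chain_oplus_otimes a b c : a ⊕ b = 1 -> b ⊕ c = 1 -> b <> 1 ->
  (a ⊙ b) ⊕ c = a ⊕ (b ⊙ c).
Proof.
have key x y z : mv_le x z -> x ⊕ y = 1 -> y <> 1 ->
    (x ⊙ y) ⊕ z = x ⊕ (y ⊙ z).
  move=> xz xy y1.
  have ey : ¬ x ⊕ (x ⊙ y) = y.
    by rewrite mv_oplusC mv_otimes_minus; apply: mv_minusK; rewrite /mv_le mv_negK.
  have -> : y ⊙ z = (z ⊖ x) ⊕ (x ⊙ y).
    have -> : y ⊙ z = z ⊙ (¬ x ⊕ (x ⊙ y)) by rewrite ey mv_otimesC.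
    rewrite mv_chain_otimes_oplus ?ey //; last by rewrite mv_oplusC.
    by rewrite [z ⊙ _]mv_otimesC mv_otimes_minus mv_negK.
  by rewrite mv_oplusA [x ⊕ (z ⊖ x)]mv_oplusC mv_minusK // mv_oplusC.
move=> ab bc b1; have [ac|ca] := chainC a c; first exact: key.
have := key c b a ca; rewrite mv_oplusC => /(_ bc b1) e.
by rewrite mv_oplusC (mv_otimesC a) -e mv_oplusC (mv_otimesC c).
Qed.

End ChainArithmetic.
Notation "a ⊙ b" := (mv_otimes a b) (at level 40, left associativity) : mv_scope.

(* The pair (m, a) stands for m u + a, with u the strong unit; a ≠ 1 makes the
   representation unique. *)
Definition chang (C : mvAlgebra) of mv_chain C & mv_zero <> mv_one :> C : Type :=
  {p : int * C | p.2 <> mv_one}.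

(** * Integer and fractional parts, addition with carry, and the order of the group *)

Section ChangGroup.
Variable C : mvAlgebra.
Hypotheses (chainC : mv_chain C) (ntC : mv_zero <> mv_one :> C).
Implicit Types a b c : C.
Local Open Scope ring_scope.
Local Notation one := (mv_one : C).
Local Notation G := (chang chainC ntC).

HB.instance Definition _ := gen_eqMixin G.
HB.instance Definition _ := gen_choiceMixin G.

Definition mv_carry a b : int := `[< a ⊕ b = one >]%:Z.
Definition mv_csum a b : C := if `[< a ⊕ b = one >] then a ⊙ b else a ⊕ b.

Lemma mv_csum_neq1 a b : b <> one -> mv_csum a b <> one.
Proof.
by rewrite /mv_csum => b1; case: asboolP => // _; apply: mv_otimes_neq1.
Qed.

Lemma mv_csumC a b : mv_csum a b = mv_csum b a.
Proof. by rewrite /mv_csum mv_oplusC mv_otimesC. Qed.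

Lemma mv_carryC a b : mv_carry a b = mv_carry b a.
Proof. by rewrite /mv_carry mv_oplusC. Qed.

Lemma mv_carry1 a b : a ⊕ b = one -> mv_carry a b = 1.
Proof. by rewrite /mv_carry => /asboolT ->. Qed.

Lemma mv_carry0 a b : a ⊕ b <> one -> mv_carry a b = 0.
Proof. by rewrite /mv_carry => /asboolF ->. Qed.

Lemma mv_csum1 a b : a ⊕ b = one -> mv_csum a b = a ⊙ b.
Proof. by rewrite /mv_csum => /asboolT ->. Qed.

Lemma mv_csum0 a b : a ⊕ b <> one -> mv_csum a b = a ⊕ b.
Proof. by rewrite /mv_csum => /asboolF ->. Qed.

(** Fractional parts and carries are compared together, by cases on which of [a ⊕ b] and [b ⊕ c]
    overflow; the two mixed cases mirror each other. *)
Lemma mv_csum_assoc a b c : b <> one ->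
  mv_csum (mv_csum a b) c = mv_csum a (mv_csum b c) /\
  mv_carry a b + mv_carry (mv_csum a b) c =
  mv_carry b c + mv_carry a (mv_csum b c).
Proof.
have mixed x y z : x ⊕ y = one -> y ⊕ z <> one ->
    mv_csum (mv_csum x y) z = mv_csum x (mv_csum y z) /\
    mv_carry x y + mv_carry (mv_csum x y) z =
    mv_carry y z + mv_carry x (mv_csum y z).
  move=> xy yz; rewrite (mv_carry1 xy) (mv_csum1 xy) (mv_carry0 yz) (mv_csum0 yz).
  have pz : (x ⊙ y) ⊕ z <> one.
    move=> e; apply/yz/mv_le1_eq; rewrite -e.
    by apply: mv_le_oplus (mv_le_refl _); apply: mv_otimes_ler.
  have xq : x ⊕ (y ⊕ z) = one by rewrite mv_oplusA xy mv_oplusC mv_oplus1.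
  rewrite (mv_carry0 pz) (mv_csum0 pz) (mv_carry1 xq) (mv_csum1 xq).
  by rewrite mv_chain_otimes_oplus.
move=> b1.
have [ab|ab] := pselect (a ⊕ b = one); have [bc|bc] := pselect (b ⊕ c = one).
- rewrite (mv_carry1 ab) (mv_csum1 ab) (mv_carry1 bc) (mv_csum1 bc).
  have [pc|pc] := pselect ((a ⊙ b) ⊕ c = one).
    have aq := mv_chain_carry chainC ab bc b1 pc.
    rewrite (mv_carry1 pc) (mv_csum1 pc) (mv_carry1 aq) (mv_csum1 aq).
    by rewrite mv_otimesA.
  have e := mv_chain_oplus_otimes chainC ab bc b1.
  have aq : a ⊕ (b ⊙ c) <> one by rewrite -e.
  by rewrite (mv_carry0 pc) (mv_csum0 pc) (mv_carry0 aq) (mv_csum0 aq).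
- exact: mixed.
- have [] := mixed c b a; rewrite 1?mv_oplusC // 1?mv_oplusC // => e1 e2.
  rewrite (mv_csumC a (mv_csum b c)) (mv_csumC _ c) (mv_csumC b c) (mv_csumC a b).
  rewrite (mv_carryC a b) (mv_carryC b c) (mv_carryC _ c) (mv_carryC a).
  by rewrite e1 e2.
- rewrite (mv_carry0 ab) (mv_csum0 ab) (mv_carry0 bc) (mv_csum0 bc).
  rewrite /mv_csum /mv_carry mv_oplusA; split=> //; case: ifP => // _.
  have [->|b0] := pselect (b = mv_zero); first by rewrite mv_oplusx0 mv_oplus0x.
  (* Negation exchanges [⊕] and [⊙], so the case without inner carries becomes the case with two.
     There the middle term [¬ b] must differ from 1, which is why [b = mv_zero] was split off. *)
  have dual x y : x ⊕ y <> one -> ¬ x ⊕ ¬ y = one.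
    by move=> xy; have [//|] := chainC x (¬ y); rewrite /mv_le mv_negK mv_oplusC.
  have nb1 : ¬ b <> one by move=> e; apply: b0; rewrite -(mv_negK b) e mv_neg1.
  have := mv_chain_oplus_otimes chainC (dual _ _ ab) (dual _ _ bc) nb1.
  by rewrite /mv_otimes !mv_negK => ->.
Qed.

Definition chang_int (x : G) : int := (sval x).1.
Definition chang_frac (x : G) : C := (sval x).2.
Definition chang_pair (m : int) a (a1 : a <> one) : G := exist _ (m, a) a1.

Lemma chang_frac_neq1 (x : G) : chang_frac x <> one.
Proof. exact: (svalP x). Qed.

Lemma chang_eq (x y : G) :
  chang_int x = chang_int y -> chang_frac x = chang_frac y -> x = y.
Proof.
case: x y => [[m a] a1] [[n b] b1]; rewrite /chang_int /chang_frac /= => e1 e2.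
exact/eq_exist/(congr2 pair e1 e2).
Qed.

Definition chang_zero : G := chang_pair 0 ntC.
Definition chang_unit : G := chang_pair 1 ntC.

Definition chang_add (x y : G) : G :=
  chang_pair (chang_int x + chang_int y + mv_carry (chang_frac x) (chang_frac y))
    (mv_csum_neq1 (a := chang_frac x) (chang_frac_neq1 (x := y))).

Lemma chang_intD x y : chang_int (chang_add x y) =
  chang_int x + chang_int y + mv_carry (chang_frac x) (chang_frac y).
Proof. by []. Qed.

Lemma chang_fracD x y :
  chang_frac (chang_add x y) = mv_csum (chang_frac x) (chang_frac y).
Proof. by []. Qed.

(** The negative of m + a is (-m - 1) + [¬ a], except for a = 0, where [¬ a] is the excluded
    fractional part 1. *)
Definition chang_frac_neg a : C := if `[< a = mv_zero >] then mv_zero else ¬ a.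

Fact chang_frac_neg_neq1 a : chang_frac_neg a <> one.
Proof.
rewrite /chang_frac_neg; case: asboolP => // a0 e.
by apply: a0; rewrite -(mv_negK a) e mv_neg1.
Qed.

Definition chang_opp (x : G) : G :=
  chang_pair (- chang_int x - (~~ `[< chang_frac x = mv_zero >])%:Z)
    (@chang_frac_neg_neq1 (chang_frac x)).

Lemma chang_intN x : chang_int (chang_opp x) =
  - chang_int x - (~~ `[< chang_frac x = mv_zero >])%:Z.
Proof. by []. Qed.

Fact chang_addA : associative chang_add.
Proof.
move=> x y z; have [e1 e2] :=
  mv_csum_assoc (chang_frac x) (chang_frac z) (chang_frac_neq1 (x := y)).
apply: chang_eq; last exact: esym e1.
rewrite !chang_intD !chang_fracD; lia.
Qed.

Fact chang_addC : commutative chang_add.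
Proof.
move=> x y; apply: chang_eq; last exact: mv_csumC.
by rewrite /chang_int /= mv_carryC [chang_int x + _]addrC.
Qed.

Fact chang_add0 : left_id chang_zero chang_add.
Proof.
move=> x; have e : mv_zero ⊕ chang_frac x <> one.
  by rewrite mv_oplus0x; apply: chang_frac_neq1.
apply: chang_eq; first by rewrite chang_intD (mv_carry0 e) add0r addr0.
by rewrite chang_fracD (mv_csum0 e) mv_oplus0x.
Qed.

Fact chang_addN : left_inverse chang_zero chang_opp chang_add.
Proof.
move=> x; have x1 := @chang_frac_neq1 x.
have i0 : chang_int chang_zero = 0 by [].
have [x0|x0] := pselect (chang_frac x = mv_zero).
  have e : chang_frac (chang_opp x) = mv_zero.
    by rewrite [LHS]/(chang_frac_neg _) (asboolT x0).
  apply: chang_eq; last by rewrite chang_fracD e x0 mv_csum0 mv_oplusx0.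
  rewrite chang_intD e x0 mv_carry0 ?mv_oplusx0 // chang_intN (asboolT x0) /=.
  by rewrite i0; lia.
have e : chang_frac (chang_opp x) = ¬ chang_frac x.
  by rewrite [LHS]/(chang_frac_neg _) (asboolF x0).
apply: chang_eq.
  rewrite chang_intD e mv_carry1 ?mv_oplusN // chang_intN (asboolF x0) /=.
  by rewrite i0; lia.
by rewrite chang_fracD e mv_csum1 ?mv_oplusN // mv_otimes_minus mv_negK
  mv_minusxx.
Qed.

HB.instance Definition _ := GRing.isZmodule.Build G
  chang_addA chang_addC chang_add0 chang_addN.

(** The fractional part lies in [0, 1), so the integer part alone decides nonnegativity. *)
Definition chang_nonneg (x : G) : Prop := 0 <= chang_int x.

Lemma chang_nonnegD x y :
  chang_nonneg x -> chang_nonneg y -> chang_nonneg (x + y).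
Proof. by rewrite /chang_nonneg chang_intD /mv_carry; lia. Qed.

Lemma chang_nonneg_total x : chang_nonneg x \/ chang_nonneg (- x).
Proof. by rewrite /chang_nonneg chang_intN; case: asboolP => _ /=; lia. Qed.

Lemma chang_nonneg_anti x : chang_nonneg x -> chang_nonneg (- x) -> x = 0.
Proof.
rewrite /chang_nonneg chang_intN; case: asboolP => /= x0; last lia.
by move=> h1 h2; apply: chang_eq => //=; rewrite [RHS]/chang_int /=; lia.
Qed.

(** The element 1 cannot serve as a fractional part and is sent to the strong unit. *)
Definition chang_inj a : G :=
  if pselect (a = one) is right a1 then chang_pair 0 a1 else chang_unit.

Lemma chang_inj_nonneg a : chang_nonneg (chang_inj a).
Proof. by rewrite /chang_inj; case: pselect. Qed.

Lemma chang_inj1 : chang_inj one = chang_unit.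
Proof. by rewrite /chang_inj; case: pselect. Qed.

Lemma chang_inj0 : chang_inj mv_zero = 0.
Proof. by rewrite /chang_inj; case: pselect => // h; apply: chang_eq. Qed.

Lemma chang_injI : injective chang_inj.
Proof.
move=> a b; rewrite /chang_inj; case: pselect => a1; case: pselect => b1 //.
- by rewrite a1 b1.
- by move=> /(congr1 chang_frac).
Qed.

(** Truncated addition min(u, a + b) as a disjunction of sign conditions in the group, the form that
    passes to rational numbers. *)
Lemma chang_inj_oplus a b :
  a ⊕ b = one /\ chang_nonneg (chang_inj a + chang_inj b - chang_inj one) \/
  chang_inj (a ⊕ b) = chang_inj a + chang_inj b.
Proof.
have [->|a1] := pselect (a = one).
  left; rewrite mv_oplusC mv_oplus1; split=> //.
  by rewrite addrAC subrr add0r; apply: chang_inj_nonneg.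
have [->|b1] := pselect (b = one).
  left; rewrite mv_oplus1; split=> //.
  by rewrite -addrA subrr addr0; apply: chang_inj_nonneg.
have [ab|ab] := pselect (a ⊕ b = one).
  left; split=> //; rewrite chang_inj1 /chang_inj.
  case: pselect => // a1'; case: pselect => // b1'.
  rewrite /chang_nonneg !chang_intD chang_intN (mv_carry1 ab) (asboolT (erefl _)).
  by rewrite /mv_carry; case: asboolP.
right; rewrite /chang_inj; case: pselect => // ab1.
case: pselect => // a1'; case: pselect => // b1'.
apply: chang_eq; rewrite /chang_int /chang_frac /=.
  by rewrite mv_carry0.
by rewrite mv_csum0.
Qed.

Lemma chang_inj_neg a : chang_inj (¬ a) + chang_inj a = chang_inj one.
Proof.
rewrite chang_inj1.
have [->|a0] := pselect (a = mv_zero); first by rewrite chang_inj0 addr0 chang_inj1.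
have [->|a1] := pselect (a = one); first by rewrite mv_neg1 chang_inj0 add0r chang_inj1.
rewrite /chang_inj; case: pselect => [e|na1].
  by case: a0; rewrite -(mv_negK a) e mv_neg1.
case: pselect => // a1'; apply: chang_eq; rewrite /chang_int /chang_frac /=.
  by rewrite mv_carry1 ?mv_oplusN.
by rewrite mv_csum1 ?mv_oplusN // mv_otimes_minus mv_negK mv_minusxx.
Qed.

End ChangGroup.

(** * Rational points realizing prescribed signs *)

Section FourierMotzkin.
Variables (G : zmodType) (nonneg : G -> Prop).
Hypothesis nonnegD : forall g h, nonneg g -> nonneg h -> nonneg (g + h)%R.
Hypothesis nonneg_total : forall g, nonneg g \/ nonneg (- g)%R.
Hypothesis nonneg_anti : forall g, nonneg g -> nonneg (- g)%R -> g = 0%R.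
Local Open Scope ring_scope.

(** Takes the values of [sgz], so that signs in the group and in the rationals can be equated. *)
Definition gsg (g : G) : int := if g == 0 then 0 else if `[< nonneg g >] then 1 else -1.

Lemma gsg0 : gsg 0 = 0.
Proof. by rewrite /gsg eqxx. Qed.

Lemma gsg_eq0 g : (gsg g == 0) = (g == 0).
Proof. by rewrite /gsg; case: ifP => // _; case: ifP. Qed.

Lemma gsgN g : gsg (- g) = - gsg g.
Proof.
rewrite /gsg oppr_eq0; case: eqP => [//|g0].
case: asboolP => h1; case: asboolP => h2 //.
  by case: g0; apply: nonneg_anti.
by case: (nonneg_total g).
Qed.

Lemma gsgP g : [\/ gsg g = 1, gsg g = 0 | gsg g = -1].
Proof.
rewrite /gsg; case: eqP => _; first by constructor 2.
by case: ifP; [constructor 1|constructor 3].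
Qed.

Lemma gsg1_nonneg g : gsg g = 1 -> nonneg g.
Proof. by rewrite /gsg; case: eqP => // _; case: asboolP. Qed.

Lemma nonneg_gsg g : nonneg g -> 0 <= gsg g.
Proof. by rewrite /gsg; case: eqP => // _ /asboolT ->. Qed.

Lemma gsgD1 g h : gsg g = 1 -> gsg h = 1 -> gsg (g + h) = 1.
Proof.
move=> g1 h1; have gh0 : g + h != 0.
  apply/eqP => /eqP; rewrite addr_eq0 => /eqP e.
  by move: g1; rewrite e gsgN h1.
rewrite /gsg (negbTE gh0) asboolT //.
by apply: nonnegD; apply: gsg1_nonneg.
Qed.

Lemma gsgMn g n : gsg (g *+ n.+1) = gsg g.
Proof.
have key k : gsg k = 1 -> gsg (k *+ n.+1) = 1.
  by move=> k1; elim: n => [|n IH] //; rewrite mulrS; apply: gsgD1.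
have [h|/eqP h|h] := gsgP g; first by rewrite key.
  by move: h; rewrite gsg_eq0 => /eqP ->; rewrite mul0rn.
apply: oppr_inj; rewrite -gsgN -mulNrn h key // gsgN h.
by rewrite opprK.
Qed.

Lemma gsgMz g c : gsg (g *~ c) = gsg g * sgz c.
Proof.
case: c => [[|n]|n]; first by rewrite mulr0z gsg0 mulr0.
  by rewrite -pmulrn gsgMn mulr1.
by rewrite NegzE mulrNz gsgN -pmulrn gsgMn mulrN1.
Qed.

Lemma rat_between (lo hi : seq rat) :
  (forall a b, a \in lo -> b \in hi -> a < b) ->
  exists x, (forall a, a \in lo -> a < x) /\ (forall b, b \in hi -> x < b).
Proof.
have maxP (s : seq rat) :
    s = [::] \/ exists2 m, m \in s & forall a, a \in s -> a <= m.
  elim: s => [|a s [->|[m ms mP]]]; first by left.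
    by right; exists a; [rewrite inE|move=> b; rewrite inE => /eqP ->].
  right; exists (Num.max a m).
    by rewrite /Num.max; case: ifP => _; rewrite inE ?eqxx ?ms ?orbT.
  by move=> b; rewrite inE le_max => /orP[/eqP ->|/mP ->]; rewrite ?lexx ?orbT.
have minP (s : seq rat) :
    s = [::] \/ exists2 m, m \in s & forall a, a \in s -> m <= a.
  have [e|[m ms mP]] := maxP [seq - a | a <- s]; first by left; case: s e.
  right; exists (- m); first by case/mapP: ms => a sa ->; rewrite opprK.
  by move=> a sa; rewrite lerNl; apply/mP/map_f.
move=> lohi; have [->|[m mlo mP]] := maxP lo; have [->|[n nhi nP]] := minP hi.
- by exists 0.
- by exists (n - 1); split=> // b /nP; lra.
- by exists (m + 1); split=> // a /mP; lra.
- have mn := lohi _ _ mlo nhi; exists ((m + n) / 2).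
  by split=> [a /mP|b /nP]; lra.
Qed.

Lemma sgz_mulrz (q : rat) (c : int) : sgz (q *~ c) = sgz q * sgz c.
Proof. by rewrite -mulrzr sgzM sgz_int. Qed.

(** Here [c t] is the coefficient of the eliminated variable, and [m t] and [r t] are the rest of
    the form in the group and in the rationals. A form with [c t] nonzero that vanishes at [h]
    dictates [x]. Otherwise [h] separates the roots of the forms into two sides, and [x] is put in
    the corresponding rational gap. *)
Lemma eliminate_variable (T : finType) (c : T -> int) (m : T -> G)
    (r : T -> rat) (h : G) :
  (forall t, gsg (m t) = sgz (r t)) ->
  (forall s t, gsg (m t *~ c s - m s *~ c t) = sgz (r t *~ c s - r s *~ c t)) ->
  exists x : rat, forall t, gsg (h *~ c t + m t) = sgz (x *~ c t + r t).
Proof.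
move=> Hm Hmm.
have scale t k x : k != 0 ->
    gsg ((h *~ c t + m t) *~ k) = sgz ((x *~ c t + r t) *~ k) ->
    gsg (h *~ c t + m t) = sgz (x *~ c t + r t).
  by move=> k0; rewrite gsgMz sgz_mulrz; apply: mulIf; rewrite sgz_eq0.
have [/existsP[s /andP[cs /eqP hs]]|/existsPn nz] :=
  boolP [exists s, (c s != 0) && (h *~ c s + m s == 0)].
  have csQ : (c s)%:~R != 0 :> rat by rewrite intr_eq0.
  exists (- r s / (c s)%:~R) => t; apply: (scale _ (c s)) => //.
  have -> : (h *~ c t + m t) *~ c s = m t *~ c s - m s *~ c t.
    rewrite mulrzDl -mulrzA mulrC mulrzA addrC; congr (_ + _).
    by rewrite -mulNrz; congr (_ *~ _); apply/eqP; rewrite -addr_eq0 hs.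
  by rewrite Hmm; congr sgz; field.
pose e t := gsg ((h *~ c t + m t) *~ c t).
pose rho t : rat := - r t / (c t)%:~R.
have [] := @rat_between [seq rho t | t <- enum T & (c t != 0) && (e t == 1)]
  [seq rho t | t <- enum T & (c t != 0) && (e t == -1)].
  move=> _ _ /mapP[s + ->] /mapP[t + ->]; rewrite !mem_filter.
  move=> /andP[/andP[cs /eqP es] _] /andP[/andP[ct /eqP et] _].
  have csQ : (c s)%:~R != 0 :> rat by rewrite intr_eq0.
  have ctQ : (c t)%:~R != 0 :> rat by rewrite intr_eq0.
  have sq (k : int) : k != 0 -> sgz (k * k) = 1.
    by move=> k0; apply/eqP; rewrite sgz_cp0 -expr2 exprn_even_gt0.
  have e1 : gsg ((h *~ c s + m s) *~ c s *~ (c t * c t)) = 1.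
    by rewrite gsgMz -/(e s) es sq.
  have e2 : gsg (- ((h *~ c t + m t) *~ c t *~ (c s * c s))) = 1.
    by rewrite gsgN gsgMz -/(e t) et sq.
  have := gsgD1 e1 e2.
  have -> : (h *~ c s + m s) *~ c s *~ (c t * c t) -
      (h *~ c t + m t) *~ c t *~ (c s * c s) =
      (m s *~ c t - m t *~ c s) *~ (c s * c t).
    rewrite !mulrzDl -!mulrzA opprD addrACA.
    rewrite [X in h *~ X - _](_ : _ = c t * (c t * (c s * c s))); last by ring.
    rewrite subrr add0r mulNrz -!mulrzA; congr (_ *~ _ - _ *~ _); ring.
  rewrite gsgMz Hmm -sgz_mulrz => /eqP; rewrite sgz_cp0 => H.
  rewrite -subr_gt0 (_ : _ - _ = (r s *~ c t - r t *~ c s) *~ (c s * c t) /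
    ((c s)%:~R ^+ 2 * (c t)%:~R ^+ 2)); last by rewrite /rho; field; apply/andP.
  apply: divr_gt0 => //; apply: mulr_gt0; rewrite exprn_even_gt0 //=.
move=> x [xlo xhi]; exists x => t.
have [c0|c0] := eqVneq (c t) 0; first by rewrite c0 !mulr0z !add0r.
apply: (scale _ (c t)) => //.
have c0Q : (c t)%:~R != 0 :> rat by rewrite intr_eq0.
have c2 : 0 < (c t)%:~R ^+ 2 :> rat by rewrite exprn_even_gt0.
have -> : (x *~ c t + r t) *~ c t = (x - rho t) * (c t)%:~R ^+ 2.
  by rewrite /rho; field.
rewrite sgzM (gtr0_sgz c2) mulr1.
have [et|et0|et] := gsgP ((h *~ c t + m t) *~ c t).
- rewrite et; apply/esym/eqP; rewrite sgz_cp0 subr_gt0; apply: xlo.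
  by apply: map_f; rewrite mem_filter c0 /e et eqxx mem_enum.
- move: (nz t); rewrite c0 /= -gsg_eq0.
  by move/eqP: et0; rewrite gsgMz mulf_eq0 sgz_eq0 (negbTE c0) orbF => ->.
- rewrite et; apply/esym/eqP; rewrite sgz_cp0 subr_lt0; apply: xhi.
  by apply: map_f; rewrite mem_filter c0 /e et eqxx mem_enum.
Qed.

(** Induction on the number of variables, with the family of forms generalised because each
    elimination enlarges it. *)
Lemma rational_sign_model n (T : finType) (L : T -> nat -> int) (g : nat -> G) :
  exists q : nat -> rat, forall t,
    gsg (\sum_(i < n) g i *~ L t i) = sgz (\sum_(i < n) q i *~ L t i).
Proof.
elim: n T L => [|n IH] T L.
  by exists (fun _ => 0) => t; rewrite !big_ord0 gsg0 sgz0.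
(* Besides the truncated forms, L' lists all combinations of two forms in which
   the last variable cancels; their signs record the relative order of the
   values of that variable at which the forms vanish. *)
pose L' (u : T + T * T) i := match u with
  | inl t => L t i | inr (s, t) => L t i * L s n - L s i * L t n end.
have sumE (V : zmodType) (v : nat -> V) s t :
    \sum_(i < n) v i *~ L' (inr (s, t)) i =
    (\sum_(i < n) v i *~ L t i) *~ L s n - (\sum_(i < n) v i *~ L s i) *~ L t n.
  by rewrite !mulrz_suml -sumrB; apply: eq_bigr => i _; rewrite mulrzBr !mulrzA.
have [q Hq] := IH _ L'.
have [s t|x Hx] := @eliminate_variable T (L^~ n)
  (fun t => \sum_(i < n) g i *~ L t i) (fun t => \sum_(i < n) q i *~ L t i) (g n)
  (fun t => Hq (inl t)).
  by rewrite -!sumE.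
exists (fun i => if i == n then x else q i) => t.
rewrite !big_ord_recr /= eqxx addrC Hx addrC; congr (sgz (_ + _)).
by apply: eq_bigr => i _; rewrite ltn_eqF.
Qed.

End FourierMotzkin.

(** * Approximation by finite chains *)

(** [S] need not be closed under the operations: only the arguments are required to lie in it.
    [{classic A}] supplies the decidable equality behind list membership. *)
Definition local_morphism (A B : mvAlgebra) (S : seq {classic A}) (f : A -> B) :=
  [/\ forall x y : A, (x : {classic A}) \in S -> (y : {classic A}) \in S ->
        f (x ⊕ y) = f x ⊕ f y,
      forall x : A, (x : {classic A}) \in S -> f (¬ x) = ¬ f x
    & f mv_zero = mv_zero].

(* f is a map into the MV-algebra [0, 1] ∩ ℚ that is a local morphism on S. *)
Definition rational_model (A : mvAlgebra) (S : seq {classic A}) (f : A -> rat) :=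
  [/\ f mv_zero = 0%R,
      forall x : A, (x : {classic A}) \in S -> (0 <= f x <= 1)%R,
      forall x : A, (x : {classic A}) \in S -> f (¬ x) = (1 - f x)%R
    & forall x y : A, (x : {classic A}) \in S -> (y : {classic A}) \in S ->
        f (x ⊕ y) = Num.min 1%R (f x + f y)%R].

Section RationalModels.
Local Open Scope ring_scope.

Lemma sum_mulrz_delta (V : zmodType) n (v : nat -> V) (j : 'I_n) :
  \sum_(i < n) v i *~ (i == j)%:Z = v j.
Proof.
rewrite (bigD1 j) //= eqxx big1 ?addr0 // => i /negbTE.
by rewrite -val_eqE /= => ->; rewrite mulr0z.
Qed.

Lemma chain_rational_model (C : mvAlgebra) (S : seq {classic C}) :
  mv_chain C -> mv_zero <> mv_one :> C ->
  exists2 f : C -> rat, rational_model S f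
    & forall x y : C, (x : {classic C}) \in S -> (y : {classic C}) \in S ->
        f x = f y -> x = y.
Proof.
move=> chainC ntC; pose CC := {classic C}.
(* One round of the operations, since the model must control [¬ x] and [x ⊕ y] for [x] and [y] in
   [S]. *)
pose S' : seq CC := [:: (mv_zero : C) : CC, (mv_one : C) : CC & S ++
  [seq (¬ (x : C) : CC) | x <- S] ++
  [seq ((x : C) ⊕ (y : C) : CC) | x <- S, y <- S]].
have S'0 : ((mv_zero : C) : CC) \in S' by rewrite inE eqxx.
have S'1 : ((mv_one : C) : CC) \in S' by rewrite !inE eqxx orbT.
have S'x x : x \in S -> x \in S' by rewrite !inE !mem_cat => ->; rewrite !orbT.
have S'N x : x \in S -> ((¬ (x : C)) : CC) \in S'.
  by move=> xS; rewrite !inE !mem_cat (map_f (fun x : CC => ¬ (x : C) : CC) xS) !orbT.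
have S'D x y : x \in S -> y \in S -> (((x : C) ⊕ (y : C)) : CC) \in S'.
  move=> xS yS; rewrite !inE !mem_cat.
  by rewrite (allpairs_f (fun x y : CC => (x : C) ⊕ (y : C) : CC) xS yS) !orbT.
move: S' S'0 S'1 S'x S'N S'D => S' S'0 S'1 S'x S'N S'D.
pose n := size S'.
pose iota : C -> chang chainC ntC := @chang_inj C chainC ntC.
pose N : chang chainC ntC -> Prop := @chang_nonneg C chainC ntC.
pose g i := iota (nth ((mv_zero : C) : CC) S' i).
(* Forms v_a + v_b - v_c - v_d express sums and comparisons alike; the element 0 pads shorter
   relations. *)
pose L (t : 'I_n * 'I_n * ('I_n * 'I_n)) (i : nat) : int :=
  (i == t.1.1)%:Z + (i == t.1.2)%:Z - (i == t.2.1)%:Z - (i == t.2.2)%:Z.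
have sumL (V : zmodType) (v : nat -> V) t :
    \sum_(i < n) v i *~ L t i = v t.1.1 + v t.1.2 - v t.2.1 - v t.2.2.
  under eq_bigr => i _ do rewrite !mulrzDr !mulrNz.
  by rewrite !big_split /= !sumrN !sum_mulrz_delta.
have [q Hq] := @rational_sign_model _ N (@chang_nonnegD _ _ _)
  (@chang_nonneg_total _ _ _) (@chang_nonneg_anti _ _ _) n _ L g.
pose Q (x : C) : rat := q (index (x : CC) S').
have sgnQ (a b c d : C) : (a : CC) \in S' -> (b : CC) \in S' ->
    (c : CC) \in S' -> (d : CC) \in S' ->
    gsg N (iota a + iota b - iota c - iota d) = sgz (Q a + Q b - Q c - Q d).
  move=> aS bS cS dS.
  have lt x : x \in S' -> (index x S' < n)%N by rewrite index_mem.
  have := Hq (Ordinal (lt _ aS), Ordinal (lt _ bS),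
    (Ordinal (lt _ cS), Ordinal (lt _ dS))).
  by rewrite !sumL /= /g !nth_index.
have iota0 : iota mv_zero = 0 by apply: chang_inj0.
have ge (a b c d : C) : (a : CC) \in S' -> (b : CC) \in S' ->
    (c : CC) \in S' -> (d : CC) \in S' ->
    N (iota a + iota b - iota c - iota d) -> Q c + Q d <= Q a + Q b.
  move=> aS bS cS dS /nonneg_gsg; rewrite sgnQ // sgz_ge0; lra.
have eq (a b c d : C) : (a : CC) \in S' -> (b : CC) \in S' ->
    (c : CC) \in S' -> (d : CC) \in S' ->
    iota a + iota b = iota c + iota d <-> Q a + Q b = Q c + Q d.
  move=> aS bS cS dS; have := sgnQ a b c d aS bS cS dS.
  rewrite -!addrA -!opprD !addrA => e; split=> h.
    move/eqP: e; rewrite h subrr gsg0 eq_sym sgz_eq0 subr_eq0 => /eqP //.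
  by move/eqP: e; rewrite h subrr sgz0 gsg_eq0 subr_eq0 => /eqP.
have Q0 x : (x : CC) \in S' -> Q mv_zero <= Q x.
  move=> xS; suff: Q mv_zero + Q mv_zero <= Q x + Q mv_zero by lra.
  by apply: ge => //; rewrite iota0 !subr0 addr0; apply: chang_inj_nonneg.
have Q1 x : (x : CC) \in S' -> Q x <= Q mv_one.
  move=> xS; suff: Q x + Q mv_zero <= Q mv_one + Q mv_zero by lra.
  apply: ge => //; rewrite iota0 subr0 addr0 /iota -(chang_inj_neg chainC ntC x) addrK.
  exact: chang_inj_nonneg.
have Q01 : Q mv_zero < Q mv_one.
  rewrite lt_neqAle Q0 // andbT; apply/eqP => e.
  have /eq : Q mv_zero + Q mv_zero = Q mv_one + Q mv_zero by rewrite e.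
  by move=> /(_ S'0 S'0 S'1 S'0) /addIr /chang_injI.
(* The coefficients of each form add up to 0, so signs do not see translations and [Q mv_zero] need
   not be 0. The affine change sends it to 0 and [Q mv_one] to 1. *)
pose f (x : C) := (Q x - Q mv_zero) / (Q mv_one - Q mv_zero).
have D0 : 0 < Q mv_one - Q mv_zero by rewrite subr_gt0.
have f1 : f mv_one = 1 by rewrite /f divff // gt_eqF.
have fI x y : f x = f y -> Q x = Q y.
  by move=> /(mulIf (invr_neq0 (lt0r_neq0 D0))) /addIr.
exists f; last first.
  move=> x y xS yS /fI e; have : Q x + Q mv_zero = Q y + Q mv_zero by rewrite e.
  by move/eq => /(_ (S'x _ xS) S'0 (S'x _ yS) S'0) /addIr /chang_injI.
split.
- by rewrite /f subrr mul0r.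
- move=> x /S'x xS; apply/andP; split.
    by rewrite divr_ge0 ?subr_ge0 ?Q0 //; apply: ltW.
  by rewrite /f ler_pdivrMr // mul1r lerD2r Q1.
- move=> x xS; have : Q (¬ x) + Q x = Q mv_one + Q mv_zero.
    apply/eq => //; [exact: S'N|exact: S'x|rewrite iota0 addr0].
    exact: chang_inj_neg.
  move=> e; have {}e : Q (¬ x) = Q mv_one + Q mv_zero - Q x by lra.
  by rewrite /f e; field; rewrite gt_eqF.
- move=> x y xS yS; have [xS' yS'] := (S'x _ xS, S'x _ yS).
  have [[xy1 h]|h] := chang_inj_oplus chainC ntC x y.
    have : Q mv_one + Q mv_zero <= Q x + Q y by apply: ge => //; rewrite iota0 subr0.
    move=> le; rewrite xy1 f1 min_l // /f -mulrDl ler_pdivlMr // mul1r; lra.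
  have : Q (x ⊕ y) + Q mv_zero = Q x + Q y.
    by apply/eq => //; [apply: S'D|rewrite iota0 addr0].
  move=> e; have le := Q1 _ (S'D _ _ xS yS).
  have -> : f x + f y = f (x ⊕ y) by rewrite /f -mulrDl; congr (_ / _); lra.
  by rewrite min_r // /f ler_pdivrMr // mul1r lerD2r.
Qed.

Lemma common_denominator (s : seq rat) : exists2 N : nat, (0 < N)%N
  & forall r, r \in s -> 0 <= r -> exists k : nat, r * N%:R = k%:R.
Proof.
elim: s => [|r s [N N0 HN]]; first by exists 1%N.
exists (N * `|denq r|)%N; first by rewrite muln_gt0 N0 absz_gt0 denq_neq0.
have dE : `|denq r|%N%:R = (denq r)%:~R :> rat.
  by rewrite pmulrn abszE gtr0_norm ?denq_gt0.
move=> a; rewrite inE => /orP[/eqP -> r0|/HN + a0]; last first.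
  by move=> /(_ a0)[k ek]; exists (k * `|denq r|)%N; rewrite !natrM mulrA ek.
exists (N * `|numq r|)%N; rewrite !natrM dE mulrCA; congr (_ * _).
rewrite -{1}(divq_num_den r) mulfVK ?intr_eq0 ?denq_neq0 //.
by rewrite [RHS]pmulrn abszE ger0_norm ?numq_ge0.
Qed.

End RationalModels.

(* The element k stands for k / N; luk 0 is the trivial algebra. *)
Definition luk (N : nat) : Type := 'I_N.+1.

Section Lukasiewicz.
Variable N : nat.
Implicit Types a b : luk N.

Fact luk_oplus_subproof a b : minn N (a + b) < N.+1.
Proof. by rewrite ltnS geq_minl. Qed.

Fact luk_neg_subproof a : N - a < N.+1.
Proof. by rewrite ltnS leq_subr. Qed.

Definition luk_oplus a b : luk N := Ordinal (luk_oplus_subproof a b).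
Definition luk_neg a : luk N := Ordinal (luk_neg_subproof a).
Definition luk_zero : luk N := ord0.

Fact luk_oplusA : associative luk_oplus.
Proof. by move=> a b c; apply: val_inj => /=; lia. Qed.

Fact luk_oplusC : commutative luk_oplus.
Proof. by move=> a b; apply: val_inj => /=; lia. Qed.

Fact luk_oplusx0 : right_id luk_zero luk_oplus.
Proof. by move=> a; apply: val_inj => /=; have := ltn_ord a; lia. Qed.

Fact luk_negK : involutive luk_neg.
Proof. by move=> a; apply: val_inj => /=; have := ltn_ord a; lia. Qed.

Fact luk_oplusx1 : right_zero (luk_neg luk_zero) luk_oplus.
Proof. by move=> a; apply: val_inj => /=; lia. Qed.

Fact luk_lukasiewicz a b : luk_oplus (luk_neg (luk_oplus (luk_neg a) b)) b =
  luk_oplus (luk_neg (luk_oplus (luk_neg b) a)) a.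
Proof. by apply: val_inj => /=; have := ltn_ord a; have := ltn_ord b; lia. Qed.

HB.instance Definition _ := isMVAlgebra.Build (luk N)
  luk_oplusA luk_oplusC luk_oplusx0 luk_negK luk_oplusx1 luk_lukasiewicz.

Lemma luk_finite : mv_finite (luk N).
Proof. exact: (@finite_finset 'I_N.+1). Qed.

Lemma luk_chain : mv_chain (luk N).
Proof.
move=> a b; case: (leqP a b) => ab; [left|right]; apply: val_inj => /=;
  have := ltn_ord a; have := ltn_ord b; lia.
Qed.

End Lukasiewicz.

(** Exact where [f x * N] is a natural number at most [N]. Elsewhere truncation and the default
    value of [inord] merely make the map total. *)
Definition luk_approx (A : Type) (N : nat) (f : A -> rat) (x : A) : luk N :=
  inord (Num.truncn (f x * N%:R)%R).

(** * From rational models to finite chains *)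

Section Discretization.
Variables (A : mvAlgebra) (S : seq {classic A}) (N : nat) (f : A -> rat).
Hypothesis fS : rational_model S f.
Hypothesis fN : forall x : A, (x : {classic A}) \in S ->
  exists k : nat, (f x * N%:R)%R = k%:R%R.
Local Open Scope ring_scope.

Lemma val_luk_approx (x : A) (k : nat) :
  f x * N%:R = k%:R -> (k <= N)%N -> val (luk_approx N f x) = k.
Proof. by move=> e kN; rewrite /luk_approx e natrK /= inordK. Qed.

Lemma luk_approx_nat (x : A) : (x : {classic A}) \in S ->
  exists2 k : nat, (k <= N)%N & f x * N%:R = k%:R.
Proof.
move=> xS; have [k ek] := fN xS; exists k => //.
case: fS => _ f01 _ _; have /andP[_ fx1] := f01 _ xS.
by rewrite -(ler_nat rat) -ek ler_piMl.
Qed.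

(** Even if [¬ x] or [x ⊕ y] lies outside [S], the model gives its numerator as [N - k] or
    [minn N (k + l)], so no rounding occurs. *)
Lemma luk_approx_local_morphism : local_morphism S (luk_approx N f).
Proof.
case: fS => f0 _ fNeg fD; split=> [x y xS yS|x xS|]; apply: val_inj.
- have [k kN ek] := luk_approx_nat xS; have [l lN el] := luk_approx_nat yS.
  rewrite /= (val_luk_approx ek kN) (val_luk_approx el lN).
  apply: val_luk_approx; last exact: geq_minl.
  by rewrite fD // minr_pMl ?ler0n // mul1r mulrDl ek el -natrD -natr_min.
- have [k kN ek] := luk_approx_nat xS.
  rewrite /= (val_luk_approx ek kN); apply: val_luk_approx; last exact: leq_subr.
  by rewrite fNeg // mulrBl mul1r ek natrB.
- by apply: val_luk_approx; rewrite // f0 mul0r.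
Qed.

Lemma luk_approx_inj (x y : A) : (0 < N)%N ->
  (x : {classic A}) \in S -> (y : {classic A}) \in S ->
  luk_approx N f x = luk_approx N f y -> f x = f y.
Proof.
move=> N0 xS yS; have [k kN ek] := luk_approx_nat xS.
have [l lN el] := luk_approx_nat yS => /(congr1 val).
rewrite (val_luk_approx ek kN) (val_luk_approx el lN) => kl.
by apply: (@mulIf _ N%:R); rewrite ?pnatr_eq0 -?lt0n // ek el kl.
Qed.

End Discretization.

(** * Embeddings into ultraproducts *)

Local Open Scope classical_set_scope.

(** Each instance of the morphism laws involves at most two elements, so it holds on a cone of
    indices. The class [K] is left abstract to serve both finite chains and finite subalgebras of
    powers. *)
Lemma ultraproduct_embedding (K : mvAlgebra -> Prop) (A : mvAlgebra) :
  (forall S : seq {classic A}, exists (B : mvAlgebra) (f : A -> B),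
     [/\ K B, local_morphism S f
       & forall x y : A, (x : {classic A}) \in S -> (y : {classic A}) \in S ->
           f x = f y -> x = y]) ->
  exists (I : Type) (U : set_system I) (UF : UltraFilter U) (F : I -> mvAlgebra),
    (forall i, K (F i)) /\ mv_embeds A (ultraproduct F UF).
Proof.
move=> H; pose I := seq {classic A}.
pose F (S : I) : mvAlgebra := projT1 (cid (H S)).
pose f (S : I) : A -> F S := projT1 (cid (projT2 (cid (H S)))).
have fP S : [/\ K (F S), local_morphism S (f S)
    & forall x y : A, (x : {classic A}) \in S -> (y : {classic A}) \in S ->
        f S x = f S y -> x = y] := projT2 (cid (projT2 (cid (H S)))).
pose above (S : I) : set I := [set S' : seq {classic A} | {subset S <= S'}].
have aboveP : ProperFilter (filter_from [set: I] above).
  apply: filter_from_proper => [|S _]; last by exists S => x.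
  apply: filter_from_filter; first by exists [::].
  move=> S S' _ _; exists (S ++ S') => // S'' sub.
  by split=> x xS; apply: sub; rewrite mem_cat xS ?orbT.
have [U [UF sU]] := ultraFilterLemma aboveP.
have eventually (S : I) (P : set I) :
    (forall S' : seq {classic A}, {subset S <= S'} -> P S') -> U P.
  by move=> SP; apply: sU; exists S.
exists I, U, UF, F; split; first by move=> S; case: (fP S).
pose h (x : A) : mv_prod F := fun S => f S x.
exists (fun x => ultra_class UF (h x)); first split.
- move=> x y; rewrite -[RHS]ultra_class_oplus; apply/ultra_class_eq.
  apply: (eventually [:: x : {classic A}; y : {classic A}]) => S sub /=.
  by case: (fP S) => _ [fD _ _] _; apply: fD; apply: sub; rewrite !inE eqxx ?orbT.
- move=> x; rewrite -[RHS]ultra_class_neg; apply/ultra_class_eq.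
  apply: (eventually [:: x : {classic A}]) => S sub /=.
  by case: (fP S) => _ [_ fN _] _; apply: fN; apply: sub; rewrite inE.
- apply/ultra_class_eq; apply: (eventually [::]) => S _ /=.
  by case: (fP S) => _ [].
(* Some index at which the images agree also contains [x] and [y]; injectivity at that single index
   suffices. *)
- move=> x y /ultra_class_eq Uxy.
  have : U [set S : seq {classic A} |
      {subset [:: x : {classic A}; y : {classic A}] <= S}].
    by apply: (eventually [:: x : {classic A}; y : {classic A}]).
  move=> /(filterI Uxy) /filter_ex[S [/= e sub]].
  by case: (fP S) => _ _; apply=> //; apply: sub; rewrite !inE eqxx ?orbT.
Qed.

Lemma mv_trivial (A : mvAlgebra) (x y : A) : mv_zero = mv_one :> A -> x = y.
Proof.
move=> e01; have z t : t = mv_zero :> A by rewrite -(mv_oplusx0 t) e01 mv_oplus1.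
by rewrite (z x) (z y).
Qed.

Lemma mv_chain_embedding (A : mvAlgebra) : mv_chain A ->
  exists (I : Type) (U : set_system I) (UF : UltraFilter U) (F : I -> mvAlgebra),
    (forall i, mv_finite (F i) /\ mv_chain (F i)) /\
    mv_embeds A (ultraproduct F UF).
Proof.
move=> chA; apply: (@ultraproduct_embedding (fun B => mv_finite B /\ mv_chain B)) => S.
have [triv|ntA] := pselect (mv_zero = mv_one :> A).
  (* The trivial algebra is its own finite chain; the Chang group requires 0 and 1 to differ. *)
  exists A, id; split=> //; split=> //.
  apply: (@sub_finite_set _ _ [set mv_zero]); last exact: finite_set1.
  by move=> x _; apply: mv_trivial.
have [f fS finj] := chain_rational_model S chA ntA.
have [N N0 HN] := common_denominator [seq f x | x <- S].
have fN (x : A) : (x : {classic A}) \in S -> exists k : nat, (f x * N%:R)%R = k%:R%R.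
  move=> xS; apply: HN; first exact: (map_f (f : {classic A} -> rat)).
  by case: fS => _ /(_ _ xS)/andP[].
exists (luk N), (luk_approx N f); split.
- by split; [apply: luk_finite|apply: luk_chain].
- exact: luk_approx_local_morphism.
- by move=> x y xS yS /(luk_approx_inj fS fN N0 xS yS); apply: finj.
Qed.

Lemma rational_model_comp (A C : mvAlgebra) (h : A -> C) (S : seq {classic A})
    (f : C -> rat) : mv_morphism h ->
  rational_model [seq (h x : {classic C}) | x <- S] f ->
  rational_model S (f \o h).
Proof.
move=> [hD hN h0] [f0 f01 fN fD].
have mem (x : A) : (x : {classic A}) \in S ->
    (h x : {classic C}) \in [seq (h y : {classic C}) | y <- S].
  exact: (map_f (fun y : {classic A} => h y : {classic C})).
split=> /= [|x xS|x xS|x y xS yS]; first by rewrite h0.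
- exact/f01/mem.
- by rewrite hN fN //; apply: mem.
- by rewrite hD fD //; apply: mem.
Qed.

Lemma rational_model_separation (A : mvAlgebra) (S : seq {classic A}) (x y : A) :
  (x : {classic A}) \in S -> (y : {classic A}) \in S -> x <> y ->
  exists2 f : A -> rat, rational_model S f & f x <> f y.
Proof.
move=> xS yS /mv_chain_separation[C [h [chC mh hxy]]].
have ntC : mv_zero <> mv_one :> C by move=> /(mv_trivial (h x) (h y)).
have mem := map_f (fun y : {classic A} => h y : {classic C}).
have [f fS finj] := chain_rational_model [seq (h z : {classic C}) | z <- S] chC ntC.
exists (f \o h); first exact: rational_model_comp.
by move=> /= e; apply: hxy; apply: finj e; apply: mem.
Qed.

Lemma luk_power_finite n N : mv_finite (mv_power n (luk N)).
Proof.
pose ev (g : {ffun 'I_n -> 'I_N.+1}) : mv_power n (luk N) := fun i => g i.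
apply: (@sub_finite_set _ _ (ev @` setT)).
  by move=> g _; exists [ffun i => g i] => //; apply/funext => i; apply: ffunE.
exact/finite_image/finite_finset.
Qed.

(** One coordinate for each pair of positions of [S] with distinct entries, given by a rational
    model separating them. A single denominator for the values of all these models puts every
    coordinate into the same [luk N]. *)
Lemma mv_power_local_embedding (A : mvAlgebra) (S : seq {classic A}) :
  exists (n N : nat) (f : A -> mv_power n (luk N)), local_morphism S f /\
    forall x y : A, (x : {classic A}) \in S -> (y : {classic A}) \in S ->
      f x = f y -> x = y.
Proof.
pose x_ (i : 'I_(size S)) : {classic A} := tnth (in_tuple S) i.
have xS i : x_ i \in S by apply: mem_tnth.
pose T : finType := {t : 'I_(size S) * 'I_(size S) | x_ t.1 != x_ t.2}.
have /choice[f fP] : forall t : T, exists f : A -> rat,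
    rational_model S f /\ f (x_ (val t).1) <> f (x_ (val t).2).
  move=> t; have /eqP ne := valP t.
  by have [f fS fne] := rational_model_separation (xS _) (xS _) ne; exists f.
have [N N0 HN] := common_denominator [seq f t x | t <- enum T, x <- S].
have fN t (x : A) : (x : {classic A}) \in S ->
    exists k : nat, (f t x * N%:R)%R = k%:R%R.
  move=> xS'; apply: HN.
    by apply: (allpairs_f (fun t (x : {classic A}) => f t x)) => //; rewrite mem_enum.
  by case: (fP t) => -[_ /(_ _ xS')/andP[]].
have lm t := luk_approx_local_morphism (proj1 (fP t)) (fN t).
exists #|T|, N, (fun x i => luk_approx N (f (enum_val i)) x); split.
  split=> [x y x1 y1|x x1|]; apply/funext => i; have [D Neg Z] := lm (enum_val i).
  - exact: D.
  - exact: Neg.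
  - exact: Z.
move=> x y x1 y1 e; apply: contrapT => ne.
have /tnthP[i xi] : (x : {classic A}) \in in_tuple S by [].
have /tnthP[j yj] : (y : {classic A}) \in in_tuple S by [].
have nij : x_ (i, j).1 != x_ (i, j).2 by apply/eqP; rewrite /x_ /= -xi -yj.
pose t : T := exist _ (i, j) nij.
have [fS fne] := fP t; apply: fne.
rewrite /x_ /= -xi -yj; apply: (luk_approx_inj fS (fN t) N0 x1 y1).
by have := congr1 (fun g => g (enum_rank t)) e; rewrite /= enum_rankK.
Qed.

(** Bundles all the data of one factor, so that a single choice yields the whole family of factors
    in (2). *)
Record chain_ultraproduct := ChainUltraproduct {
  cu_index : Type;
  cu_system : set_system cu_index;
  cu_ultra : UltraFilter cu_system;
  cu_family : cu_index -> mvAlgebra;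
  cu_finite_chain : forall i, mv_finite (cu_family i) /\ mv_chain (cu_family i)
}.

Definition chain_ultraproduct_sort (D : chain_ultraproduct) : mvAlgebra :=
  ultraproduct (@cu_family D) (cu_ultra D).

Lemma chain_ultraproduct_separation (A : mvAlgebra) (x y : A) : x <> y ->
  exists (D : chain_ultraproduct) (h : A -> chain_ultraproduct_sort D),
    mv_morphism h /\ h x <> h y.
Proof.
move=> /mv_chain_separation[C [h [chC [hD hN h0] hne]]].
have [I [U [UF [F [Ffin [g [gD gN g0] ginj]]]]]] := mv_chain_embedding chC.
exists (ChainUltraproduct UF Ffin), (g \o h); split; last by move=> /ginj.
by split=> /= [a b|a|]; rewrite ?hD ?gD ?hN ?gN ?h0 ?g0.
Qed.

Theorem theorem6 :
  (forall A : mvAlgebra, mv_chain A ->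
    exists (I : Type) (U : set_system I) (UF : UltraFilter U)
           (F : I -> mvAlgebra),
      (forall i, mv_finite (F i) /\ mv_chain (F i)) /\
      mv_embeds A (ultraproduct F UF))
  /\
  (forall A : mvAlgebra,
    exists (J : Type) (I : J -> Type) (U : forall j, set_system (I j))
           (UF : forall j, UltraFilter (U j))
           (F : forall j, I j -> mvAlgebra),
      (forall j i, mv_finite (F j i) /\ mv_chain (F j i)) /\
      mv_embeds A (mv_prod (fun j => ultraproduct (F j) (UF j))))
  /\
  (forall A : mvAlgebra,
    exists (I : Type) (U : set_system I) (UF : UltraFilter U)
           (F : I -> mvAlgebra),
      (forall i, mv_finite (F i) /\
         exists (n : nat) (C : mvAlgebra),
           [/\ mv_finite C, mv_chain C & mv_embeds (F i) (mv_power n C)]) /\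
      mv_embeds A (ultraproduct F UF)).
Proof.
split; first exact: mv_chain_embedding.
split=> A; last first.
  apply: (@ultraproduct_embedding (fun B => mv_finite B /\ exists n C,
    [/\ mv_finite C, mv_chain C & mv_embeds B (mv_power n C)])) => S.
  have [n [N [f [fS finj]]]] := mv_power_local_embedding S.
  exists (mv_power n (luk N)), f; split=> //; split; first exact: luk_power_finite.
  by exists n, (luk N); split; [exact: luk_finite|exact: luk_chain|exists id].
(* One factor per pair of distinct elements: the coordinate of the pair itself separates it, whence
   injectivity. *)
pose J := {p : A * A | p.1 <> p.2}.
have H (j : J) : {D : chain_ultraproduct & {h : A -> chain_ultraproduct_sort D |
    mv_morphism h /\ h (sval j).1 <> h (sval j).2}}.
  have [D /cid[h hP]] := cid (chain_ultraproduct_separation (svalP j)).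
  by exists D, h.
have {H} [D hP] := all_tag H.
exists J, (fun j => cu_index (D j)), (fun j => @cu_system (D j)),
  (fun j => cu_ultra (D j)), (fun j => @cu_family (D j)).
split; first by move=> j; apply: cu_finite_chain.
exists (fun x j => sval (hP j) x).
  split=> [x y|x|]; apply: functional_extensionality_dep => j;
    have [[hD hN h0] _] := svalP (hP j).
  - exact: hD.
  - exact: hN.
  - exact: h0.
move=> x y e; apply: contrapT => ne.
pose j : J := exist _ (x, y) ne.
by case: (svalP (hP j)) => _; apply; apply: (congr1 (fun g => g j) e).
Qed.
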